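(* For all integers $i,j,k>0$ there is a constant $c=c(i,j,k)$ (independent of $x$) such that, as polynomials in $x$, $$\mathcal{B}_i(x)\mathcal{B}_j(x)\mathcal{B}_k(x)=\sum_{0\le q\le t}B_{2q}B_{2t-2q}\Big[\binom{i+j-2q}{2t-2q}\frac{1}{i+j-2q}\Big(\frac{1}{i}\binom{i}{2q}+\frac{1}{j}\binom{j}{2q}\Big)+\binom{i+k-2q}{2t-2q}\frac{1}{i+k-2q}\Big(\frac{1}{i}\binom{i}{2q}+\frac{1}{k}\binom{k}{2q}\Big)+\binom{j+k-2q}{2t-2q}\frac{1}{j+k-2q}\Big(\frac{1}{j}\binom{j}{2q}+\frac{1}{k}\binom{k}{2q}\Big)\Big]\mathcal{B}_{i+j+k-2t}(x)$$ $$-\frac{(-1)^j}{ij\binom{i+j}{i}}B_{i+j}\mathcal{B}_k(x)-\frac{(-1)^k}{ik\binom{i+k}{i}}B_{i+k}\mathcal{B}_j(x)-\frac{(-1)^k}{jk\binom{j+k}{j}}B_{j+k}\mathcal{B}_i(x)-\frac12\mathcal{B}_{i+j+k-2}(x)+c.$$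
   Context: $B_n(x)$ is the $n$-th Bernoulli polynomial, $\frac{te^{xt}}{e^t-1}=\sum_{n\ge0}B_n(x)\frac{t^n}{n!}$, and $B_n=B_n(0)$ is the $n$-th Bernoulli number (so $B_1=-1/2$). For $s\ge1$, $\mathcal{B}_s(x)=B_s(x)/s$ is the divided Bernoulli polynomial. The sum runs over integers $q,t$ with $0\le q\le t$; binomial coefficients $\binom{a}{b}$ with $a\ge0$ and $b>a$ are $0$, and each of the three summands in the square bracket is taken to be $0$ whenever both binomial coefficients in its inner parenthesis vanish (so only terms with positive denominators contribute, and the sum is finite). *)

(* Defs.v *)
From mathcomp Require Import all_boot all_order all_algebra.
From mathcomp Require Import zify.

Set Implicit Arguments.
Unset Strict Implicit.
Unset Printing Implicit Defensive.

Import Order.TTheory GRing.Theory Num.Theory.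
Local Open Scope ring_scope.

(* A formal power series in t over R is represented by its sequence of
   coefficients. *)
Section PowerSeries.
Variable R : comUnitRingType.
Implicit Types a b : nat -> R.

Definition fps_mul a b : nat -> R := fun n => \sum_(i < n.+1) a (n - i)%N * b i.

Fixpoint fps_div_prefix a b (n : nat) : seq R :=
  if n is m.+1 then
    let s := fps_div_prefix a b m in
    rcons s ((b 0%N)^-1 * (a m - \sum_(i < m) b (m - i)%N * s`_i))
  else [::].

(* The quotient a / b when b 0 is a unit, by long division; see fps_divK. *)
Definition fps_div a b : nat -> R := fun n => (fps_div_prefix a b n.+1)`_n.

Lemma size_fps_div_prefix a b n : size (fps_div_prefix a b n) = n.
Proof. by elim: n => //= n IHn; rewrite size_rcons IHn. Qed.

Lemma nth_fps_div_prefix a b n i :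
  (i < n)%N -> (fps_div_prefix a b n)`_i = fps_div a b i.
Proof.
elim: n => // n IHn; rewrite ltnS leq_eqVlt => /orP[/eqP-> // | lt_in].
by rewrite /= nth_rcons size_fps_div_prefix lt_in IHn.
Qed.

Lemma fps_divE a b n :
  fps_div a b n =
  (b 0%N)^-1 * (a n - \sum_(i < n) b (n - i)%N * fps_div a b i).
Proof.
rewrite {1}/fps_div /= nth_rcons size_fps_div_prefix ltnn eqxx.
by congr (_ * (_ - _)); apply: eq_bigr => i _; rewrite nth_fps_div_prefix.
Qed.

Lemma fps_divK a b n :
  b 0%N \is a GRing.unit -> fps_mul b (fps_div a b) n = a n.
Proof.
move=> ub; rewrite /fps_mul big_ord_recr /= subnn [fps_div _ _ n]fps_divE.
by rewrite mulVKr // addrC subrK.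
Qed.

End PowerSeries.

(* e^(xt), with 'X playing the role of x *)
Definition exp_xt : nat -> {poly rat} := fun n => (n`!%:R)^-1 *: 'X^n.

(* e^t - 1 *)
Definition expm1_t : nat -> {poly rat} :=
  fun n => if n is 0%N then 0 else ((n`!%:R)^-1)%:P.

(* (e^t - 1) / t *)
Definition expm1_t_div_t : nat -> {poly rat} := fun n => expm1_t n.+1.

(* t e^(xt) *)
Definition t_exp_xt : nat -> {poly rat} :=
  fun n => if n is m.+1 then exp_xt m else 0.

(* B_n(x) / n! is the coefficient of t^n in
   t e^(xt) / (e^t - 1) = e^(xt) / ((e^t - 1) / t). *)
Definition bernoulli_poly (n : nat) : {poly rat} :=
  n`!%:R *: fps_div exp_xt expm1_t_div_t n.

Definition bernoulli (n : nat) : rat := (bernoulli_poly n).[0].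

(* Only meaningful for s >= 1; it is 0 at s = 0. *)
Definition divided_bernoulli (s : nat) : {poly rat} :=
  (s%:R)^-1 *: bernoulli_poly s.

Lemma bernoulli_poly_genfun n :
  fps_mul expm1_t (fun m => (m`!%:R)^-1 *: bernoulli_poly m) n = t_exp_xt n.
Proof.
have factK m : (m`!%:R)^-1 *: bernoulli_poly m =
    fps_div exp_xt expm1_t_div_t m.
  by rewrite scalerA mulVf ?scale1r // pnatr_eq0 -lt0n fact_gt0.
rewrite /fps_mul; case: n => [|n]; first by rewrite big_ord1 /= mul0r.
rewrite big_ord_recr /= subnn [expm1_t 0]/(0) mul0r addr0.
have u1 : expm1_t_div_t 0 \is a GRing.unit by rewrite /expm1_t_div_t /expm1_t factS fact0 muln1 invr1 unitr1.
rewrite -(fps_divK exp_xt n u1); apply: eq_bigr => i _.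
by rewrite factK /expm1_t_div_t -subSn // -ltnS.
Qed.

(* The summand  C(i+j-2q, 2t-2q) / (i+j-2q) * (C(i,2q)/i + C(j,2q)/j).
   When both inner binomials vanish it is 0, whatever the (truncated)
   subtraction i+j-2q is; otherwise 2q <= max(i,j), so that i+j-2q > 0. *)
Definition pair_coef (i j q t : nat) : rat :=
  ('C(i + j - 2 * q, 2 * t - 2 * q)%N)%:R * ((i + j - 2 * q)%N%:R)^-1 *
  ((i%:R)^-1 * ('C(i, 2 * q)%N)%:R + (j%:R)^-1 * ('C(j, 2 * q)%N)%:R).

(* Hence a sum over all 0 <= q <= t may be cut off at any t >= (i + j) / 2. *)
Lemma pair_coef_eq0 (i j q t : nat) :
  (q <= t)%N -> (i + j < 2 * t)%N -> pair_coef i j q t = 0.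
Proof.
move=> le_qt lt_ij; rewrite /pair_coef.
have [lt_q | le_q] := ltnP (i + j) (2 * q).
  have -> : 'C(i, 2 * q) = 0%N by apply: bin_small; lia.
  have -> : 'C(j, 2 * q) = 0%N by apply: bin_small; lia.
  by rewrite !mulr0 ?addr0 ?mulr0.
have -> : 'C(i + j - 2 * q, 2 * t - 2 * q) = 0%N by apply: bin_small; lia.
by rewrite !mul0r.
Qed.

(* Main.v *)
Require Import Defs.
From mathcomp Require Import all_boot all_order all_algebra.
From mathcomp Require Import ring lra zify.
Import Order.TTheory GRing.Theory Num.Theory.
Local Open Scope ring_scope.
Set Implicit Arguments.
Unset Strict Implicit.

(** Write [b_n] for the divided Bernoulli polynomial and [D] for the forward
    difference, so that [D b_n = x^(n-1)] and polynomials with equal [D] differ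
    by a constant. The symmetrised polynomial [A_n = b_n + x^(n-1)/2] involves
    only the Bernoulli numbers of even index. Since [b_n(x)] and [b_n(x+1)] are
    [A_n -+ x^(n-1)/2],
      [D (b_i b_j) = x^(j-1) A_i + x^(i-1) A_j],
      [D (b_i b_j b_k) = x^(k-1) A_i A_j + x^(j-1) A_i A_k + x^(i-1) A_j A_k
                         + x^(i+j+k-3)/4].
    The first identity gives Nielsen's expansion of [b_i b_j] up to a constant,
    which is the integral of [b_i b_j] over [[0, 1]] and is found by integrating
    by parts. The expansion turns [A_i A_j] into a combination of the [A_n] plus
    that constant and a multiple of [x^(i+j-2)]; expanding each [A_n] again in
    the second identity gives the theorem. *)

(** * Polynomials with zero derivative or zero difference *)

Lemma deriv_eq0_const (p : {poly rat}) : p^`() = 0 -> p = (p`_0)%:P.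
Proof.
move=> dp; apply/polyP=> -[|n]; rewrite coefC //=.
have := coef_deriv p n; rewrite dp coef0 => /esym/eqP.
by rewrite mulrn_eq0 /= => /eqP.
Qed.

Definition fdiff (p : {poly rat}) : {poly rat} := p \Po ('X + 1%:P) - p.

Lemma fdiffD p q : fdiff (p + q) = fdiff p + fdiff q.
Proof. by rewrite /fdiff comp_polyD; ring. Qed.

Lemma fdiffN p : fdiff (- p) = - fdiff p.
Proof. by rewrite /fdiff raddfN /=; ring. Qed.

Lemma fdiffZ a p : fdiff (a *: p) = a *: fdiff p.
Proof. by rewrite /fdiff comp_polyZ scalerBr. Qed.

Lemma fdiff_sum (I : Type) (r : seq I) (P : pred I) (F : I -> {poly rat}) :
  fdiff (\sum_(i <- r | P i) F i) = \sum_(i <- r | P i) fdiff (F i).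
Proof.
apply: (big_morph fdiff fdiffD).
by rewrite /fdiff comp_poly0 subr0.
Qed.

(** Such a [p] has period 1, so [p - p(0)] vanishes at every natural number and has more roots than
    its degree allows. *)
Lemma fdiff_eq0_const p : fdiff p = 0 -> exists c, p = c%:P.
Proof.
move=> /eqP; rewrite subr_eq0 => /eqP per.
have perE n : p.[n%:R] = p.[0].
  by elim: n => // n <-; rewrite -[in RHS]per horner_comp !hornerE natr1.
exists p.[0]; apply/eqP; rewrite -subr_eq0; apply/eqP.
set d := p - _.
apply: (@roots_geq_poly_eq0 _ d [seq n%:R | n <- iota 0 (size d)]).
- apply/allP=> _ /mapP[n _ ->].
  by rewrite /root !hornerE perE subrr.
- rewrite map_inj_uniq ?iota_uniq // => m n /eqP.
  by rewrite eqr_nat => /eqP.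
by rewrite size_map size_iota.
Qed.

(** * Derivative, coefficients and difference of the Bernoulli polynomials *)

Definition bern_egf (n : nat) : {poly rat} := (n`!%:R)^-1 *: bernoulli_poly n.

Lemma bern_egf_rec n :
  \sum_(i < n.+1) ((n.+1 - i)`!%:R)^-1 *: bern_egf i = (n`!%:R)^-1 *: 'X^n.
Proof.
rewrite -[RHS]/(t_exp_xt n.+1) -bernoulli_poly_genfun.
rewrite /fps_mul [RHS]big_ord_recr /= subnn mul0r addr0.
apply: eq_bigr => i _; have := ltn_ord i.
case E: (n.+1 - i)%N => [|m] lt; first by lia.
by rewrite /expm1_t mul_polyC.
Qed.

Lemma bern_egf0 : bern_egf 0 = 1.
Proof.
by have := bern_egf_rec 0; rewrite big_ord1 /= !invr1 !scale1r expr0.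
Qed.

Lemma fact_neq0 n : (n`!%:R : rat) != 0.
Proof. by rewrite pnatr_eq0 -lt0n fact_gt0. Qed.

(** Strong induction: differentiate the recurrence at [n.+1] and subtract the recurrence at [n]. The
    lower terms cancel by induction, leaving the top ones. *)
Lemma deriv_bern_egf n : (bern_egf n.+1)^`() = bern_egf n.
Proof.
elim/ltn_ind: n => n IHn.
have := congr1 (@deriv rat) (bern_egf_rec n.+1).
rewrite raddf_sum big_ord_recr big_ord_recl /=.
rewrite derivZ bern_egf0 derivC scaler0 add0r.
rewrite derivZ subSn // subnn invr1 scale1r (derivZ _ 'X^_) derivXn /=.
have -> : ((n.+1)`!%:R)^-1 *: ('X^n *+ n.+1) = (n`!%:R)^-1 *: 'X^n :> {poly rat}.
  rewrite -scaler_nat scalerA factS natrM; congr (_ *: _).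
  by rewrite invfM mulrAC mulVf ?mul1r // pnatr_eq0.
rewrite -bern_egf_rec big_ord_recr /= subSn // subnn invr1 scale1r => E.
apply: (@addrI _ (\sum_(i < n) ((n.+1 - i)`!%:R)^-1 *: bern_egf i)).
rewrite -E; congr (_ + _); apply: eq_bigr => i _.
by rewrite derivZ IHn.
Qed.

Lemma coef_bern_egf n m :
  (bern_egf n)`_m = if (m <= n)%N then (m`!%:R)^-1 * (bern_egf (n - m)).[0] else 0.
Proof.
elim: m n => [|m IHm] [|n] //.
- by rewrite subn0 invr1 mul1r horner_coef0.
- by rewrite subn0 invr1 mul1r horner_coef0.
- by rewrite bern_egf0 coef1.
have := coef_deriv (bern_egf n.+1) m; rewrite deriv_bern_egf IHm subSS ltnS.
have m0 : (m.+1%:R : rat) != 0 by rewrite pnatr_eq0.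
case: leqP => _ E; apply: (mulfI m0); rewrite mulr_natl -E ?mulr0 //.
by rewrite factS natrM invfM -!mulrA mulVKf.
Qed.

Lemma bern_egf_expand n :
  bern_egf n = \sum_(m < n.+1) ((n - m)`!%:R^-1 * (bern_egf m).[0]) *: 'X^(n - m).
Proof.
rewrite (reindex_inj rev_ord_inj) /=.
apply/polyP=> m; rewrite coef_bern_egf coef_sum.
case: leqP => mn.
  rewrite (bigD1 (Ordinal (mn : (m < n.+1)%N))) //= big1 => [|l /eqP lm].
    by rewrite addr0 coefZ coefXn subSS subKn // eqxx mulr1.
  rewrite coefZ coefXn subSS subKn -1?ltnS //.
  by case: eqP => [E|]; [case: lm; apply: val_inj | rewrite mulr0].
rewrite big1 // => l _; rewrite coefZ coefXn subSS subKn -1?ltnS //.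
by case: eqP => [E|]; [have := ltn_ord l; lia | rewrite mulr0].
Qed.

(** By induction both sides have the same derivative, so only their values at 0 matter. There, the
    expansion evaluated at 1 is the recurrence evaluated at 0 plus its missing top term. *)
Lemma fdiff_bern_egf n : fdiff (bern_egf n.+1) = (n`!%:R)^-1 *: 'X^n.
Proof.
have at0 m : (fdiff (bern_egf m.+1)).[0] = ((m`!%:R)^-1 *: 'X^m).[0].
  rewrite /fdiff hornerD hornerN horner_comp hornerD hornerX hornerC add0r.
  rewrite -bern_egf_rec.
  rewrite [X in X.[1]]bern_egf_expand !horner_sum big_ord_recr /=.
  rewrite subnn invr1 mul1r hornerZ hornerXn expr0 mulr1 addrK.
  by apply: eq_bigr => i _; rewrite !hornerZ hornerXn expr1n mulr1.
elim: n => [|n IHn].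
  apply/eqP; rewrite -subr_eq0; apply/eqP.
  rewrite [LHS]deriv_eq0_const.
    by rewrite -horner_coef0 hornerD hornerN at0 subrr.
  by rewrite !derivB deriv_comp deriv_bern_egf bern_egf0 !derivE comp_polyC; ring.
apply/eqP; rewrite -subr_eq0; apply/eqP; rewrite [LHS]deriv_eq0_const.
  by rewrite -horner_coef0 hornerD hornerN at0 subrr.
rewrite derivB /fdiff derivB deriv_comp deriv_bern_egf !derivE addr0 mulr1.
rewrite -/(fdiff _) IHn /= -scaler_nat scalerA factS natrM.
apply/eqP; rewrite subr_eq0; apply/eqP; congr (_ *: _).
by rewrite invfM mulrAC mulVf ?mul1r // pnatr_eq0.
Qed.

(** * Divided Bernoulli polynomials *)

Lemma divided_bernoulliS n : divided_bernoulli n.+1 = n`!%:R *: bern_egf n.+1.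
Proof.
rewrite /divided_bernoulli /bern_egf [RHS]scalerA factS natrM; congr (_ *: _).
by rewrite invfM mulrCA mulfV ?mulr1 // fact_neq0.
Qed.

Lemma fdiff_divided_bernoulli n : fdiff (divided_bernoulli n.+1) = 'X^n.
Proof.
by rewrite divided_bernoulliS fdiffZ fdiff_bern_egf scalerA mulfV ?scale1r ?fact_neq0.
Qed.

Lemma divided_bernoulli_shift n :
  divided_bernoulli n.+1 \Po ('X + 1%:P) = divided_bernoulli n.+1 + 'X^n.
Proof. by rewrite -fdiff_divided_bernoulli /fdiff [RHS]addrC subrK. Qed.

Lemma deriv_divided_bernoulli1 : (divided_bernoulli 1)^`() = 1.
Proof. by rewrite divided_bernoulliS derivZ deriv_bern_egf bern_egf0 scale1r. Qed.

Lemma deriv_divided_bernoulli n :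
  (divided_bernoulli n.+2)^`() = n.+1%:R *: divided_bernoulli n.+1.
Proof.
by rewrite !divided_bernoulliS derivZ deriv_bern_egf [RHS]scalerA -natrM -factS.
Qed.

Lemma divided_bernoulli_at0 n : (divided_bernoulli n).[0] = bernoulli n / n%:R.
Proof. by rewrite /divided_bernoulli hornerZ mulrC. Qed.

(** The correction is 1 for [n = 0] only, so [b_1] alone leaves a boundary term in integrations over
    the unit interval. *)
Lemma divided_bernoulli_at1 n :
  (divided_bernoulli n.+1).[1] = (divided_bernoulli n.+1).[0] + 0 ^+ n.
Proof.
have := congr1 (fun p => p.[0]) (divided_bernoulli_shift n).
by rewrite horner_comp !hornerD hornerX hornerC add0r hornerXn.
Qed.

(** * Integrals over the unit interval *)

(* [unit_mean p c] says that the integral of [p] over [[0, 1]] is [c]. *)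
Definition unit_mean (p : {poly rat}) (c : rat) :=
  exists2 P : {poly rat}, P^`() = p & P.[1] - P.[0] = c.

Lemma unit_meanD p q c d :
  unit_mean p c -> unit_mean q d -> unit_mean (p + q) (c + d).
Proof.
move=> [P <- <-] [Q <- <-]; exists (P + Q); first by rewrite derivD.
by rewrite !hornerD; ring.
Qed.

Lemma unit_meanZ a p c : unit_mean p c -> unit_mean (a *: p) (a * c).
Proof.
move=> [P <- <-]; exists (a *: P); first by rewrite derivZ.
by rewrite !hornerZ mulrBr.
Qed.

Lemma unit_mean_const c d : unit_mean c%:P d -> c = d.
Proof.
move=> [P dP <-].
have := @deriv_eq0_const (P - c *: 'X).
rewrite derivB derivZ derivX dP alg_polyC subrr => /(_ erefl).
set e := _`_0 => /eqP; rewrite subr_eq => /eqP ->.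
by rewrite !hornerE; ring.
Qed.

Lemma unit_mean_uniq p c d : unit_mean p c -> unit_mean p d -> c = d.
Proof.
move=> pc /(unit_meanZ (-1)) pd; have := unit_meanD pc pd.
rewrite scaleN1r subrr mulN1r -polyC0 => /unit_mean_const/esym/eqP.
by rewrite subr_eq0 => /eqP.
Qed.

Lemma unit_mean_sum (r : seq nat) (F : nat -> {poly rat}) (c : nat -> rat) :
  (forall n, n \in r -> unit_mean (F n) (c n)) ->
  unit_mean (\sum_(n <- r) F n) (\sum_(n <- r) c n).
Proof.
elim: r => [|n r IHr] Fc.
  by rewrite !big_nil; exists 0; rewrite ?deriv0 // !horner0 subrr.
rewrite !big_cons; apply: unit_meanD; first by apply: Fc; rewrite mem_head.
by apply: IHr => m rm; apply: Fc; rewrite inE rm orbT.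
Qed.

Lemma unit_mean_divided_bernoulli n : unit_mean (divided_bernoulli n.+1) 0.
Proof.
exists (n.+1%:R^-1 *: divided_bernoulli n.+2).
  by rewrite derivZ deriv_divided_bernoulli scalerA mulVf ?scale1r ?pnatr_eq0.
have := divided_bernoulli_at1 n.+1; move: (divided_bernoulli _) => p.
by rewrite !hornerZ => ->; rewrite expr0n /= addr0 subrr.
Qed.

(** The integral of [b_i b_j] over the unit interval; the sign is included, so that the theorem adds
    these constants times [b_k]. *)
Definition pair_const (i j : nat) : rat :=
  - ((-1) ^+ j / (i%:R * j%:R * ('C(i + j, i)%N)%:R) * bernoulli (i + j)%N).

Lemma pair_const1 i :
  pair_const i.+1 1 = i.+1%:R^-1 * (divided_bernoulli i.+2).[0].
Proof.
rewrite /pair_const divided_bernoulli_at0 addn1 binSn expr1 mulr1.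
by rewrite !invfM; ring.
Qed.

(** This mirrors one integration by parts, which raises the first index and lowers the second. *)
Lemma pair_constS i j :
  pair_const i.+1 j.+2 = - (j.+1%:R / i.+1%:R) * pair_const i.+2 j.+1.
Proof.
rewrite /pair_const (addSnnS i.+1 j.+1) exprS.
have E : i.+2%:R * ('C(i.+1 + j.+2, i.+2))%:R
       = j.+2%:R * ('C(i.+1 + j.+2, i.+1))%:R :> rat.
  by rewrite -!natrM mul_bin_left addKn.
have j0 : (j.+1%:R : rat) != 0 by rewrite pnatr_eq0.
rewrite [X in _ = _ * - (_ / X * _)]mulrAC E.
rewrite (_ : i.+1%:R * j.+2%:R * _ =
  i.+1%:R * (j.+2%:R * ('C(i.+1 + j.+2, i.+1))%:R)); last by rewrite mulrA.
have m0 : j.+2%:R * ('C(i.+1 + j.+2, i.+1))%:R != 0 :> rat.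
  by rewrite -natrM pnatr_eq0 -lt0n muln_gt0 bin_gt0 leq_addr.
have i0 : (i.+1%:R : rat) != 0 by rewrite pnatr_eq0.
move: m0 i0 j0; move: (j.+2%:R * _) i.+1%:R j.+1%:R => m x y m0 x0 y0.
by field; rewrite m0 x0 y0.
Qed.

(** Integrate by parts until the second index is 1. The boundary terms cancel except in that last
    case, where the jump of [b_1] by 1 produces the Bernoulli number. *)
Lemma unit_mean_mul_divided_bernoulli i j :
  unit_mean (divided_bernoulli i.+1 * divided_bernoulli j.+1) (pair_const i.+1 j.+1).
Proof.
have iV n : (n.+1%:R^-1 * n.+1%:R : rat) = 1 by rewrite mulVf // pnatr_eq0.
elim: j i => [|j IHj] i.
  exists (i.+1%:R^-1 *: (divided_bernoulli i.+2 * divided_bernoulli 1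
     - i.+2%:R^-1 *: divided_bernoulli i.+3)).
    rewrite derivZ derivB derivM (derivZ _ (divided_bernoulli _)) !deriv_divided_bernoulli.
    rewrite deriv_divided_bernoulli1 scalerA iV scale1r mulr1 addrK.
    by rewrite -scalerAl scalerA iV scale1r.
  rewrite pair_const1; move: (divided_bernoulli_at1 i.+1).
  move: (divided_bernoulli_at1 i.+2) (divided_bernoulli_at1 0).
  move: (divided_bernoulli _) (divided_bernoulli _) (divided_bernoulli _).
  move=> p q r; rewrite expr0 !expr0n /= => p1 q1 r1.
  by rewrite !(hornerZ, hornerD, hornerN, hornerM) p1 q1 r1; ring.
have [Q dQ Q01] := IHj i.+1.
exists (i.+1%:R^-1 *: (divided_bernoulli i.+2 * divided_bernoulli j.+2
   - j.+1%:R *: Q)).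
  rewrite derivZ derivB derivM (derivZ _ Q) dQ !deriv_divided_bernoulli.
  by rewrite -(scalerAr j.+1%:R) addrK -scalerAl scalerA iV scale1r.
rewrite pair_constS -Q01.
move: (divided_bernoulli_at1 i.+1) (divided_bernoulli_at1 j.+1).
move: (divided_bernoulli _) (divided_bernoulli _) => p q; rewrite !expr0n /=.
by rewrite !(hornerZ, hornerD, hornerN, hornerM) => -> ->; ring.
Qed.


(* The integral of [b_i b_j] is symmetric in [i] and [j], whereas [pair_const i j]
   changes sign under the exchange when [i + j] is odd. *)
Lemma bernoulli_odd n : bernoulli n.*2.+3 = 0.
Proof.
have := unit_mean_mul_divided_bernoulli 0 n.*2.+1.
rewrite mulrC => /(unit_mean_uniq (unit_mean_mul_divided_bernoulli _ _)).
rewrite /pair_const [(1 + _)%N]addnC addn1 expr1 exprS exprS.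
rewrite -mul2n exprM sqrrN !expr1n.
rewrite bin1 binSn mul2n.
have n2 : (n.*2.+2%:R : rat) != 0 by rewrite pnatr_eq0.
have n3 : (n.*2.+3%:R : rat) != 0 by rewrite pnatr_eq0.
move: n2 n3; move: n.*2.+2%:R n.*2.+3%:R (bernoulli _) => x y b x0 y0 /eqP.
rewrite -subr_eq0 (_ : _ - _ = 2 * x^-1 * y^-1 * b); last first.
  by field; rewrite x0 y0.
by rewrite !mulf_eq0 !invr_eq0 (negPf x0) (negPf y0) /= => /eqP.
Qed.

(** * Expansion in Bernoulli numbers of even index *)

Lemma bernoulliE n : bernoulli n = n`!%:R * (bern_egf n).[0].
Proof. by rewrite /bern_egf hornerZ mulrA mulfV ?mul1r // fact_neq0. Qed.

Lemma bernoulli1 : bernoulli 1 = - 2^-1.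
Proof.
have := congr1 (fun p => p.[0]) (bern_egf_rec 1).
rewrite bernoulliE big_ord_recr big_ord1 bern_egf0 /=; move: (bern_egf 1) => p.
rewrite hornerD !hornerZ hornerC hornerX (_ : (2 - 0)`! = 2)%N // (_ : (2 - 1)`! = 1)%N // invr1.
by lra.
Qed.

Definition even_term (n q : nat) : {poly rat} :=
  (n%:R^-1 * 'C(n, 2 * q)%:R * bernoulli (2 * q)) *: 'X^(n - 2 * q).

(* Adding [x^(n-1)/2] cancels the term of [B_1], the only nonzero Bernoulli
   number of odd index. *)
Definition even_part (n : nat) : {poly rat} :=
  divided_bernoulli n + 2^-1 *: 'X^(n.-1).

Lemma polyC_half2 : (2^-1)%:P + (2^-1)%:P = 1 :> {poly rat}.
Proof. by rewrite -polyCD (_ : 2^-1 + 2^-1 = 1 :> rat) //; lra. Qed.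

Lemma polyC_quarter : (4^-1)%:P = (2^-1)%:P * (2^-1)%:P :> {poly rat}.
Proof. by rewrite -polyCM (_ : 2^-1 * 2^-1 = 4^-1 :> rat) //; lra. Qed.

Lemma divided_bernoulli_expand n :
  divided_bernoulli n.+1 =
  \sum_(0 <= m < n.+2) (n.+1%:R^-1 * 'C(n.+1, m)%:R * bernoulli m) *: 'X^(n.+1 - m).
Proof.
rewrite divided_bernoulliS bern_egf_expand scaler_sumr big_mkord.
apply: eq_bigr => -[m /= mn] _; rewrite scalerA; congr (_ *: _).
rewrite ltnS in mn; rewrite bernoulliE.
have := congr1 (fun k => k%:R : rat) (bin_fact mn); rewrite factS !natrM.
have n0 : (n.+1%:R : rat) != 0 by rewrite pnatr_eq0.
have := fact_neq0 (n.+1 - m); move: (bern_egf m).[0] n0.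
move: n.+1%:R n`!%:R m`!%:R (_ - _)`!%:R 'C(_, _)%:R => a b c d e B a0 d0 E.
apply: (mulfI a0); rewrite !mulrA -E; field.
by rewrite a0 d0.
Qed.

Lemma big_nat_double (V : zmodType) (N : nat) (f : nat -> V) :
  \sum_(0 <= m < 2 * N) f m =
  \sum_(0 <= q < N) f (2 * q)%N + \sum_(0 <= q < N) f (2 * q).+1.
Proof.
elim: N => [|N IHN]; first by rewrite !big_geq // addr0.
rewrite mulnSr addn2 !big_nat_recr //= IHN -!addrA; congr (_ + _).
by rewrite addrCA.
Qed.

(** The bound [N] is left free so that expansions for different [n] can share one range; the
    binomials vanish beyond [n]. *)
Lemma even_part_expand n N : (0 < n)%N -> (n < 2 * N)%N ->
  even_part n = \sum_(0 <= q < N) even_term n q.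
Proof.
case: n => // n _ nN; rewrite /even_part divided_bernoulli_expand /=.
pose f m : {poly rat} := (n.+1%:R^-1 * 'C(n.+1, m)%:R * bernoulli m) *: 'X^(n.+1 - m).
have -> : \sum_(0 <= m < n.+2) f m = \sum_(0 <= m < 2 * N) f m.
  rewrite (@big_cat_nat _ _ _ n.+2 0 (2 * N)) //= [X in _ = _ + X]big_nat.
  rewrite [X in _ = _ + X]big1 ?addr0 // => m /andP[nm _].
  by rewrite /f bin_small // mulr0 mul0r scale0r.
rewrite big_nat_double -addrA [X in _ + X](_ : _ = 0) ?addr0 //.
case: N nN => [|N] nN; first by lia.
(* Among odd indices, the [B_1] term cancels the added half monomial, and those from 3 on are
   zero. *)
rewrite big_nat_recl // big1 => [|q _].
  rewrite addr0 /f muln0 bin1 bernoulli1 subSS subn0 mulVf ?pnatr_eq0 //.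
  by rewrite mul1r scaleNr addNr.
by rewrite /f mulnS mul2n bernoulli_odd mulr0 scale0r.
Qed.

(** * Product of two divided Bernoulli polynomials *)

Definition pair_weight (i j q : nat) : rat :=
  bernoulli (2 * q) * (i%:R^-1 * 'C(i, 2 * q)%:R + j%:R^-1 * 'C(j, 2 * q)%:R).

Lemma pair_weight_eq0 i j q :
  (0 < i)%N -> (0 < j)%N -> (i + j <= 2 * q)%N -> pair_weight i j q = 0.
Proof.
move=> i0 j0 ijq; rewrite /pair_weight.
have -> : 'C(i, 2 * q) = 0%N by apply: bin_small; lia.
have -> : 'C(j, 2 * q) = 0%N by apply: bin_small; lia.
by rewrite !mulr0 ?addr0 ?mulr0.
Qed.

(** The right side is the difference of the product; expanding both even parts gives the same
    monomial for each [q]. *)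
Lemma pair_weight_monomials i j N : (i.+1 + j.+1 <= N)%N ->
  \sum_(0 <= q < N) pair_weight i.+1 j.+1 q *: 'X^((i.+1 + j.+1 - 2 * q).-1) =
  'X^j * even_part i.+1 + 'X^i * even_part j.+1.
Proof.
move=> ijN; rewrite !(@even_part_expand _ N) //; try lia.
rewrite !mulr_sumr -big_split; apply: eq_bigr => q _ /=.
rewrite /pair_weight /even_term -!scalerAr -!exprD mulrDr scalerDl.
rewrite ![bernoulli _ * _]mulrC.
congr (_ + _).
  have [le|lt] := leqP (2 * q) i.+1; last by rewrite bin_small // !(mulr0, mul0r, scale0r).
  by congr (_ *: 'X^_); lia.
have [le|lt] := leqP (2 * q) j.+1; last by rewrite bin_small // !(mulr0, mul0r, scale0r).
by congr (_ *: 'X^_); lia.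
Qed.

(** This disposes of index 0, where [divided_bernoulli] is a junk value and the difference formula
    fails. *)
Lemma pair_weight_case i j q : (0 < i)%N -> (0 < j)%N ->
  pair_weight i j q = 0 \/ exists n, (i + j - 2 * q)%N = n.+1.
Proof.
move=> i0 j0; case E: (i + j - 2 * q)%N => [|n]; [left | by right; exists n].
by apply: pair_weight_eq0 => //; lia.
Qed.

(** Nielsen's expansion: equal differences give it up to a constant, which integration
    identifies. *)
Lemma mul_divided_bernoulli i j N : (i.+1 + j.+1 <= N)%N ->
  divided_bernoulli i.+1 * divided_bernoulli j.+1 =
  \sum_(0 <= q < N) pair_weight i.+1 j.+1 q *: divided_bernoulli (i.+1 + j.+1 - 2 * q)
  + (pair_const i.+1 j.+1)%:P.
Proof.
move=> ijN; set S := \sum_(0 <= q < N) _.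
have [c Ec] : exists c, divided_bernoulli i.+1 * divided_bernoulli j.+1 - S = c%:P.
  apply: fdiff_eq0_const; rewrite fdiffD fdiffN /S fdiff_sum.
  rewrite [X in _ - X](_ : _ =
    \sum_(0 <= q < N) pair_weight i.+1 j.+1 q *: 'X^((i.+1 + j.+1 - 2 * q).-1)).
    rewrite pair_weight_monomials // /fdiff /even_part comp_polyM.
    rewrite !divided_bernoulli_shift -!mul_polyC /=.
    move: polyC_half2 (divided_bernoulli _) (divided_bernoulli _) => h x y.
    (* The shifted product contributes one [x^(i+j)], and each even part removes half of it. *)
    rewrite (_ : _ - _ = 'X^i * 'X^j * (1 - ((2^-1)%:P + (2^-1)%:P))); last by ring.
    by rewrite h subrr mulr0.
  apply: eq_bigr => q _; rewrite fdiffZ.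
  have [->|[n ->]] := @pair_weight_case i.+1 j.+1 q isT isT.
    by rewrite !scale0r.
  by rewrite fdiff_divided_bernoulli.
(* Every [b_n] in [S] with nonzero weight has integral 0, so [c] is the integral of the product. *)
suff <- : c = pair_const i.+1 j.+1 by rewrite -Ec addrC subrK.
apply: unit_mean_const; rewrite -Ec -[pair_const _ _]addr0.
apply: unit_meanD; first exact: unit_mean_mul_divided_bernoulli.
rewrite -scaleN1r -[0](mulr0 (-1)); apply: unit_meanZ.
rewrite [X in unit_mean _ X](_ : 0 = \sum_(q <- index_iota 0 N) 0); last first.
  by rewrite big1.
apply: unit_mean_sum => q _.
have [->|[n ->]] := @pair_weight_case i.+1 j.+1 q isT isT.
  by rewrite scale0r; exists 0; rewrite ?deriv0 // !horner0 subrr.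
rewrite -(mulr0 (pair_weight i.+1 j.+1 q)).
exact/unit_meanZ/unit_mean_divided_bernoulli.
Qed.

(** Passing from [b] to [A] in the sum adds [x^(i+j)/2] beyond the cross terms, while the product of
    even parts adds only a quarter; hence the surplus [x^(i+j)/4]. *)
Lemma sum_pair_weight_even_part i j N : (i.+1 + j.+1 <= N)%N ->
  \sum_(0 <= q < N) pair_weight i.+1 j.+1 q *: even_part (i.+1 + j.+1 - 2 * q) =
  even_part i.+1 * even_part j.+1 + 4^-1 *: 'X^(i + j) - (pair_const i.+1 j.+1)%:P.
Proof.
move=> ijN.
have scale_even a n : a *: even_part n = a *: divided_bernoulli n + 2^-1 *: (a *: 'X^(n.-1)).
  by rewrite scalerDr; congr (_ + _); rewrite !scalerA mulrC.
under eq_bigr => q _ do rewrite scale_even.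
rewrite big_split /= -scaler_sumr pair_weight_monomials //.
move/(@mul_divided_bernoulli i j N)/eqP: (ijN); rewrite -subr_eq => /eqP <-.
rewrite /even_part /= exprD -!mul_polyC.
rewrite polyC_quarter; move: (divided_bernoulli _) (divided_bernoulli _) => x y.
by ring.
Qed.

(** * Product of three divided Bernoulli polynomials *)

Lemma sum_triangle (V : zmodType) (N : nat) (F : nat -> nat -> V) :
  \sum_(0 <= t < N) \sum_(0 <= q < t.+1) F q (t - q)%N =
  \sum_(0 <= q < N) \sum_(0 <= m < N - q) F q m.
Proof.
elim: N => [|N IHN]; first by rewrite !big_geq.
rewrite !big_nat_recr //= IHN subSn // subnn big_nat1 addrA -big_split /=.
congr (_ + _); apply: eq_big_nat => q /andP[_ qN].
by rewrite subSn 1?ltnW // big_nat_recr.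
Qed.

(** Put [t = q + m]. For fixed [q], the sum over [m] is [x^k] times the expansion of the even part
    of index [i+j+2-2q], so the previous expansion of weighted even parts applies. *)
Lemma fdiff_pair_sum i j k N : (i.+1 + j.+1 < N)%N ->
  \sum_(0 <= t < N) \sum_(0 <= q < t.+1)
    (bernoulli (2 * q) * bernoulli (2 * t - 2 * q) * pair_coef i.+1 j.+1 q t)
      *: fdiff (divided_bernoulli (i.+1 + j.+1 + k.+1 - 2 * t)) =
  'X^k * (even_part i.+1 * even_part j.+1 + 4^-1 *: 'X^(i + j)
          - (pair_const i.+1 j.+1)%:P).
Proof.
move=> ijN; rewrite -(@sum_pair_weight_even_part i j N); last by lia.
pose F q m := (bernoulli (2 * q) * bernoulli (2 * m) * pair_coef i.+1 j.+1 q (q + m))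
      *: fdiff (divided_bernoulli (i.+1 + j.+1 + k.+1 - 2 * (q + m))).
transitivity (\sum_(0 <= t < N) \sum_(0 <= q < t.+1) F q (t - q)%N).
  apply: eq_bigr => t _; apply: eq_big_nat => q /andP[_ qt].
  by rewrite /F subnKC // mulnBr.
rewrite sum_triangle mulr_sumr; apply: eq_big_nat => q /andP[_ qN].
rewrite -scalerAr.
have FE m : F q m = pair_weight i.+1 j.+1 q *: ((bernoulli (2 * m) *
    'C(i.+1 + j.+1 - 2 * q, 2 * m)%:R / (i.+1 + j.+1 - 2 * q)%:R)
      *: fdiff (divided_bernoulli (i.+1 + j.+1 + k.+1 - 2 * (q + m)))).
  rewrite scalerA /F /pair_coef /pair_weight mulnDr addKn; congr (_ *: _).
  by move: (_%:R^-1) => z; ring.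
under eq_bigr => m _ do rewrite FE.
rewrite -scaler_sumr.
have [->|[n En]] := @pair_weight_case i.+1 j.+1 q isT isT.
  by rewrite !scale0r.
congr (_ *: _); rewrite (@even_part_expand _ (N - q)); try lia.
rewrite mulr_sumr; apply: eq_bigr => m _; rewrite /even_term -scalerAr -exprD.
have [le|lt] := leqP (2 * m) (i.+1 + j.+1 - 2 * q); last first.
  by rewrite bin_small // !(mulr0, mul0r, scale0r).
(* The nonzero binomial makes the subtractions exact, and the index is positive thanks to [k.+1]. *)
have -> : (i.+1 + j.+1 + k.+1 - 2 * (q + m) = (k + (i.+1 + j.+1 - 2 * q - 2 * m)).+1)%N by lia.
rewrite fdiff_divided_bernoulli; congr (_ *: _).
by rewrite mulrC -[RHS]mulrA [X in _ * X = _]mulrC.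
Qed.

Theorem theorem2 (i j k : nat) (hi : (0 < i)%N) (hj : (0 < j)%N) (hk : (0 < k)%N) :
  exists c : rat,
    divided_bernoulli i * divided_bernoulli j * divided_bernoulli k =
      (\sum_(0 <= t < (i + j + k).+1) \sum_(0 <= q < t.+1)
        (bernoulli (2 * q)%N * bernoulli (2 * t - 2 * q)%N *
          (pair_coef i j q t + pair_coef i k q t + pair_coef j k q t))
          *: divided_bernoulli (i + j + k - 2 * t)%N)
      - ((-1) ^+ j / (i%:R * j%:R * ('C(i + j, i)%N)%:R) * bernoulli (i + j)%N)
          *: divided_bernoulli k
      - ((-1) ^+ k / (i%:R * k%:R * ('C(i + k, i)%N)%:R) * bernoulli (i + k)%N)
          *: divided_bernoulli j
      - ((-1) ^+ k / (j%:R * k%:R * ('C(j + k, j)%N)%:R) * bernoulli (j + k)%N)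
          *: divided_bernoulli i
      - 2%:R^-1 *: divided_bernoulli (i + j + k - 2)%N
      + c%:P.
Proof.
case: i hi => // i _; case: j hj => // j _; case: k hk => // k _.
rewrite -![- (_ *: divided_bernoulli _.+1)]scaleNr -!/(pair_const _ _).
set S := \sum_(0 <= t < _) _.
have dS : fdiff S =
    'X^k * (even_part i.+1 * even_part j.+1 + 4^-1 *: 'X^(i + j) - (pair_const i.+1 j.+1)%:P)
  + 'X^j * (even_part i.+1 * even_part k.+1 + 4^-1 *: 'X^(i + k) - (pair_const i.+1 k.+1)%:P)
  + 'X^i * (even_part j.+1 * even_part k.+1 + 4^-1 *: 'X^(j + k) - (pair_const j.+1 k.+1)%:P).
  rewrite -!(@fdiff_pair_sum _ _ _ (i.+1 + j.+1 + k.+1).+1); try lia.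
  rewrite -!big_split /S fdiff_sum; apply: eq_bigr => t _.
  rewrite -!big_split fdiff_sum; apply: eq_bigr => q _ /=.
  rewrite (_ : i.+1 + k.+1 + j.+1 = i.+1 + j.+1 + k.+1)%N; last by lia.
  rewrite (_ : j.+1 + k.+1 + i.+1 = i.+1 + j.+1 + k.+1)%N; last by lia.
  by rewrite fdiffZ !mulrDr !scalerDl.
(* [T] is the right side without its constant; it suffices to compare differences. *)
set T := S + _ + _ + _ - _.
have [c Ec] : exists c, divided_bernoulli i.+1 * divided_bernoulli j.+1
    * divided_bernoulli k.+1 - T = c%:P.
  apply: fdiff_eq0_const; rewrite fdiffD fdiffN /T !(fdiffD, fdiffN) dS.
  have -> : (i.+1 + j.+1 + k.+1 - 2 = (i + j + k).+1)%N by lia.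
  rewrite !(fdiffZ _ (divided_bernoulli _)) !fdiff_divided_bernoulli.
  rewrite /fdiff !comp_polyM !divided_bernoulli_shift /even_part /= -!mul_polyC.
  rewrite polyC_quarter !exprD; move: polyC_half2 (pair_const _ _)%:P (pair_const _ _)%:P (pair_const _ _)%:P.
  move: (2^-1)%:P (divided_bernoulli _) (divided_bernoulli _) (divided_bernoulli _).
  move=> u x y z h2 a b d; move: 'X^i 'X^j 'X^k => p q r.
  (* The pair constants cancel. The three quarters of [x^(i+j+k)] less the half from the last term
     leave the quarter in the difference of the triple product; everything remaining is a multiple
     of [1 - (u + u)], with [u] one half. *)
  rewrite [LHS](_ : _ = (1 - (u + u)) * (z * q * r + y * p * r + x * p * q
      + (1 + u *+ 3) * (p * q * r))); last by ring.
  by rewrite h2 subrr mul0r.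
by exists c; rewrite -Ec addrC subrK.
Qed.
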